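(* Let $G$ be a simple graph with $n$ vertices, at least one edge, maximum degree $\Delta$, and spectral moments $M_2,M_4$. Put $A=M_4/\Delta^3$, $B=M_2/\Delta$, $C=\Delta n$, and assume $A-2B+C\neq 0$. Then $$E(G)\le -\frac{B^2+B\sqrt{-A+B}\sqrt{-B+C}-C\left(A+\sqrt{-A+B}\sqrt{-B+C}\right)}{A-2B+C},$$ with equality if and only if every adjacency eigenvalue of $G$ lies in the set $\left\{\pm\Delta\frac{\sqrt{B-A}}{\sqrt{C-B}},\ \pm\Delta\right\}$.
   Context: The adjacency eigenvalues $\lambda_1,\dots,\lambda_n$ of $G$ are the eigenvalues of its adjacency matrix; $E(G)=\sum_i|\lambda_i|$ and $M_k=\sum_i\lambda_i^k$. In particular $M_2=2m$ ($m$ the number of edges) and $M_4=2\sum_i d_i^2-2m+8Q$ with $d_i$ the degrees and $Q$ the number of $4$-cycles. *)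

(* Defs.v *)
From mathcomp Require Import all_boot all_order all_algebra.
From mathcomp Require Import complex.

Set Implicit Arguments.
Unset Strict Implicit.
Unset Printing Implicit Defensive.

Import Order.TTheory GRing.Theory Num.Theory.
Local Open Scope ring_scope.

Record sgraph := SGraph {
  vertex :> finType;
  adj : rel vertex;
  adj_sym : symmetric adj;
  adj_irrefl : irreflexive adj }.

Definition degree (G : sgraph) (v : G) : nat := #|[set w | adj v w]|.

Definition max_degree (G : sgraph) : nat := (\max_(v : G) degree v)%N.

Definition adjmx (R : nzRingType) (G : sgraph) : 'M[R]_#|G| :=
  \matrix_(i, j) (adj (enum_val i) (enum_val j))%:R.

Lemma adjmx_tr (R : nzRingType) (G : sgraph) : (adjmx R G)^T = adjmx R G.
Proof. by apply/matrixP=> i j; rewrite !mxE adj_sym. Qed.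

Lemma char_poly_conj (R : comUnitRingType) n (P D : 'M[R]_n) :
  P \in unitmx -> char_poly (invmx P *m D *m P) = char_poly D.
Proof.
move=> uP; rewrite /char_poly /char_poly_mx.
pose Q := map_mx polyC P; pose Q' := map_mx polyC (invmx P).
have QK : Q' *m Q = 1%:M by rewrite -map_mxM mulVmx // map_mx1.
have -> : 'X%:M - map_mx polyC (invmx P *m D *m P) =
          Q' *m ('X%:M - map_mx polyC D) *m Q.
  rewrite !map_mxM mulmxBr mulmxBl; congr (_ - _).
  by rewrite scalar_mxC -mulmxA QK mulmx1.
by rewrite !det_mulmx mulrAC -det_mulmx QK det1 mul1r.
Qed.

Lemma char_poly_sym_split (R : rcfType) n (A : 'M[R]_n) : A^T = A ->
  exists s : seq R, char_poly A == \prod_(x <- s) ('X - x%:P).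
Proof.
move=> symA; pose f := real_complex R; pose M := map_mx f A.
have herM : M \is hermsymmx.
  apply: realsym_hermsym.
    apply/is_hermitianmxP; rewrite expr0 scale1r map_mx_id //.
    by rewrite /M map_trmx symA.
  by apply/mxOverP=> i j; rewrite mxE; apply/complex_realP; exists (A i j).
have /hermitian_normalmx /orthomx_spectralP defM := herM.
have /mxOverP Dreal := hermitian_spectral_diag_real herM.
set D := spectral_diag M in defM Dreal.
exists [seq complex.Re (D 0 i) | i <- enum 'I_n].
apply/eqP/(map_poly_inj f); rewrite map_char_poly -/M defM.
rewrite char_poly_conj ?spectral_unit //.
rewrite char_poly_trig ?diag_mx_is_trig // big_map big_enum rmorph_prod /=.
apply: eq_bigr => i _; rewrite rmorphB /= map_polyX map_polyC /= mxE eqxx mulr1n.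
by congr (_ - _%:P); rewrite /f RRe_real.
Qed.

(* The adjacency eigenvalues lambda_1, ..., lambda_n, repeated according to
   their algebraic multiplicity (see spectrumE and size_spectrum).  *)
Definition spectrum (R : rcfType) (G : sgraph) : seq R :=
  xchoose (char_poly_sym_split (adjmx_tr R G)).

Lemma spectrumE (R : rcfType) (G : sgraph) :
  char_poly (adjmx R G) = \prod_(x <- spectrum R G) ('X - x%:P).
Proof. exact/eqP/(xchooseP (char_poly_sym_split (adjmx_tr R G))). Qed.

Lemma size_spectrum (R : rcfType) (G : sgraph) : size (spectrum R G) = #|G|.
Proof.
by have := size_char_poly (adjmx R G); rewrite spectrumE size_prod_XsubC => -[].
Qed.

Definition energy (R : rcfType) (G : sgraph) : R :=
  \sum_(x <- spectrum R G) `|x|.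

Definition moment (R : rcfType) (G : sgraph) (k : nat) : R :=
  \sum_(x <- spectrum R G) x ^+ k.

(* Main.v *)
(* Put t = |lam| / Delta, so that 0 <= t <= 1 for every adjacency eigenvalue.
   Since t - t^2 = (1 - t^2) g(t^2) with g(u) = sqrt u / (1 + sqrt u) strictly
   concave, Jensen's inequality with weights 1 - t^2 bounds sum (t - t^2) by
   g(a^2) sum (1 - t^2), where a^2 is the weighted mean
   sum t^2 (1 - t^2) / sum (1 - t^2) = (B - A) / (C - B).  Equality holds iff
   t = a whenever the weight 1 - t^2 is nonzero.  With p = sqrt (B - A) and
   q = sqrt (C - B), the bound of the theorem is B + p q^2 / (p + q). *)
Require Import Defs.
From mathcomp Require Import all_boot all_order all_algebra.
From mathcomp Require Import ring lra.

Import Order.TTheory GRing.Theory Num.Theory.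
Local Open Scope ring_scope.

Lemma sum_adjmx_col (R : nzRingType) (G : sgraph) (j : 'I_#|G|) :
  \sum_i adjmx R G i j = (degree (enum_val j))%:R.
Proof.
under eq_bigr do rewrite mxE adj_sym.
rewrite -natr_sum /degree -sum1dep_card.
rewrite (reindex (enum_val : 'I_#|G| -> G)); last exact/onW_bij/enum_val_bij.
by rewrite [in RHS]big_mkcond; congr _%:R; apply: eq_bigr => i _; case: adj.
Qed.

Lemma spectrum_eigenvalue (R : rcfType) (G : sgraph) (x : R) :
  (x \in spectrum R G) = eigenvalue (adjmx R G) x.
Proof. by rewrite eigenvalue_root_char spectrumE root_prod_XsubC. Qed.

(** At a coordinate [j] where [|v 0 j|] is largest, the eigenvector equation and the triangle
    inequality bound [|x| * |v 0 j|] by the [j]-th column sum, a degree, times [|v 0 j|]. *)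
Lemma eigenvalue_le_max_degree (R : rcfType) (G : sgraph) (x : R) :
  eigenvalue (adjmx R G) x -> `|x| <= (max_degree G)%:R.
Proof.
case/eigenvalueP=> v vA vN0.
have [j0 vj0] : exists j, v 0 j != 0 by apply/rV0Pn.
have [j _ jmax] := @arg_maxP _ R _ j0 xpredT (fun j => `|v 0 j|) isT.
have vj_gt0 : 0 < `|v 0 j|.
  by apply: lt_le_trans (jmax j0 isT); rewrite normr_gt0.
rewrite -(ler_pM2r vj_gt0) -normrM.
have -> : x * v 0 j = \sum_i v 0 i * adjmx R G i j.
  by have /rowP/(_ j) := vA; rewrite !mxE => <-.
apply: le_trans (ler_norm_sum _ _ _) _.
apply: (@le_trans _ _ (\sum_i adjmx R G i j * `|v 0 j|)).
  apply: ler_sum => i _; rewrite normrM mulrC mxE normr_nat.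
  by apply: ler_wpM2l; [exact: ler0n | exact: jmax].
rewrite -mulr_suml sum_adjmx_col ler_wpM2r // ler_nat.
exact: (leq_bigmax (enum_val j)).
Qed.

Lemma max_degree_gt0 (G : sgraph) (u v : G) : adj u v -> (0 < max_degree G)%N.
Proof.
move=> uv; apply: leq_trans (leq_bigmax u).
by rewrite card_gt0; apply/set0Pn; exists v; rewrite inE.
Qed.

Lemma big_seq_eq0 (R : numDomainType) (s : seq R) (F : R -> R) :
  (forall t, t \in s -> 0 <= F t) ->
  \sum_(t <- s) F t = 0 <-> forall t, t \in s -> F t = 0.
Proof.
move=> F_ge0; rewrite big_seq; split=> [/eqP | F0]; last exact: big1.
rewrite psumr_eq0 // => /allP F0 t ts.
by have := F0 t ts; rewrite ts => /eqP.
Qed.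

Lemma sum_le_weighted (R : rcfType) (s : seq R) (a : R) :
  0 <= a -> (forall t, t \in s -> 0 <= t <= 1) ->
  \sum_(t <- s) t ^+ 2 * (1 - t ^+ 2) = a ^+ 2 * \sum_(t <- s) (1 - t ^+ 2) ->
  let b := \sum_(t <- s) t ^+ 2 + a / (1 + a) * \sum_(t <- s) (1 - t ^+ 2) in
  \sum_(t <- s) t <= b /\
  (\sum_(t <- s) t = b <-> forall t, t \in s -> t = a \/ t = 1).
Proof.
move=> a_ge0 s01 mean b.
have a1N0 : 1 + a != 0 by apply: lt0r_neq0; lra.
(* With g as above, [F t] is (1 - t^2) times the tangent to g at a^2 minus g, taken at t^2, cleared
   of denominators by the factor 2a(1 + a)^2. The double root at [a] is the tangency. *)
pose F t := (1 - t) * (t - a) ^+ 2 * (t + 1 + 2 * a).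
have F_ge0 t : t \in s -> 0 <= F t.
  move=> /s01/andP[t_ge0 t_le1].
  apply: mulr_ge0; last by lra.
  by apply: mulr_ge0; [lra | exact: sqr_ge0].
(* The gap between the concave function and its tangent at [a ^+ 2]. *)
have gap : 2 * a * (1 + a) ^+ 2 * (b - \sum_(t <- s) t) = \sum_(t <- s) F t.
  have -> : \sum_(t <- s) F t =
      2 * a * (1 + a) ^+ 2 * (\sum_(t <- s) t ^+ 2 - \sum_(t <- s) t)
      + (2 * a ^+ 2 * (1 + a) - a ^+ 2) * \sum_(t <- s) (1 - t ^+ 2)
      + \sum_(t <- s) t ^+ 2 * (1 - t ^+ 2).
    rewrite -sumrB !mulr_sumr -!big_split /=.
    by apply: eq_bigr => t _; rewrite /F; ring.
  (* By [mean] the last sum equals a^2 times the sum of 1 - t^2 and cancels the term with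
     coefficient -a^2. *)
  by rewrite mean /b; field.
have F_eq0 : \sum_(t <- s) F t = 0 <-> forall t, t \in s -> t = a \/ t = 1.
  apply: iff_trans (big_seq_eq0 _ _ _ F_ge0) _.
  split=> H t ts.
    have /andP[t_ge0 t_le1] := s01 t ts; have /eqP := H t ts.
    rewrite /F 2!mulf_eq0 sqrf_eq0 !subr_eq0.
    rewrite (_ : (_ + _ == 0) = false) ?orbF; last first.
      by apply/negbTE/lt0r_neq0; lra.
    by case/orP=> /eqP ->; [right | left].
  by case: (H t ts) => ->; rewrite /F; ring.
(* At a = 0 the tangent is vertical and the factor in [gap] vanishes. Then [gap] forces the sum of
   [F] to be 0, so each t is 0 or 1 and t = t^2. *)
have [a0 | aN0] := eqVneq a 0.
  have s0 : forall t, t \in s -> t = a \/ t = 1.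
    by apply/F_eq0; rewrite -gap a0; ring.
  suff -> : \sum_(t <- s) t = b by split.
  rewrite /b a0 mul0r mul0r addr0; apply: eq_big_seq => t ts.
  by case: (s0 t ts) => ->; rewrite ?a0; ring.
have k_gt0 : 0 < 2 * a * (1 + a) ^+ 2.
  have a_gt0 : 0 < a by rewrite lt0r aN0.
  by rewrite mulr_gt0 ?exprn_gt0 //; lra.
split.
  rewrite -subr_ge0 -(pmulr_rge0 _ k_gt0) gap big_seq.
  exact: sumr_ge0.
apply: iff_trans F_eq0; rewrite -gap; split=> [-> | /eqP].
  by rewrite subrr mulr0.
by rewrite mulf_eq0 (gt_eqF k_gt0) /= subr_eq0 => /eqP.
Qed.

(** The outer parentheses hold -(q^2 - p^2)B - pq^2(q - p), so a factor q - p cancels. Here B + q^2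
    and B - p^2 stand for C and A. *)
Lemma energy_bound_alt (R : rcfType) (B p q : R) :
  0 <= p -> 0 <= q -> q ^+ 2 != p ^+ 2 ->
  - ((B ^+ 2 + B * p * q
      - (B + q ^+ 2) * (B - p ^+ 2 + p * q)) / (q ^+ 2 - p ^+ 2))
  = B + (p / q) / (1 + p / q) * q ^+ 2 :> R.
Proof.
(* For [q = 0] both sides equal [B]. *)
move=> p_ge0 q_ge0 neq.
have pDq_N0 : p + q != 0.
  apply: contra neq; rewrite paddr_eq0 // => /andP[/eqP-> /eqP->].
  by rewrite eqxx.
have dN0 : q ^+ 2 - p ^+ 2 != 0 by rewrite subr_eq0.
have [q0 | qN0] := eqVneq q 0.
  have pN0 : p != 0 by move: pDq_N0; rewrite q0 addr0.
  by rewrite q0 invr0; field.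
have qDp_N0 : q + p != 0 by rewrite addrC.
by field; rewrite qN0 qDp_N0 dN0.
Qed.

Lemma norm_div_mem (R : rcfType) (D a x : R) : 0 < D -> 0 <= a ->
  (`|x| / D = a \/ `|x| / D = 1) <-> x \in [:: D * a; - (D * a); D; - D].
Proof.
move=> D_gt0 a_ge0.
have eqD c : 0 <= c -> (`|x| / D == c) = (x == D * c) || (x == - (D * c)).
  move=> c_ge0; have DN0 := lt0r_neq0 D_gt0.
  rewrite (can2_eq (divfK DN0) (mulfK DN0)) eqr_norml [c * D]mulrC.
  by rewrite mulr_ge0 ?(ltW D_gt0) // andbT.
(* Writing [D] as [D * 1] lets [eqD] apply with c = 1 as well. *)
rewrite !inE orbA -eqD // -{4 5}[D]mulr1 -eqD //.
split; first by case=> /eqP->; rewrite ?orbT.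
by case/orP=> /eqP; [left | right].
Qed.

Theorem theorem2p4 (R : rcfType) (G : sgraph)
    (has_edge : exists u v : G, adj u v) :
  let n : R := #|G|%:R in
  let Delta : R := (max_degree G)%:R in
  let A : R := moment R G 4 / Delta ^+ 3 in
  let B : R := moment R G 2 / Delta in
  let C : R := Delta * n in
  A - 2%:R * B + C != 0 ->
  energy R G <=
    - ((B ^+ 2 + B * Num.sqrt (- A + B) * Num.sqrt (- B + C)
        - C * (A + Num.sqrt (- A + B) * Num.sqrt (- B + C)))
       / (A - 2%:R * B + C))
  /\
  (energy R G =
    - ((B ^+ 2 + B * Num.sqrt (- A + B) * Num.sqrt (- B + C)
        - C * (A + Num.sqrt (- A + B) * Num.sqrt (- B + C)))
       / (A - 2%:R * B + C))
   <->
   forall lam : R, eigenvalue (adjmx R G) lam ->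
     lam \in [:: Delta * (Num.sqrt (B - A) / Num.sqrt (C - B));
                 - (Delta * (Num.sqrt (B - A) / Num.sqrt (C - B)));
                 Delta; - Delta]).
Proof.
move=> n D A B C dN0.
have D_gt0 : 0 < D by case: has_edge => u [v /max_degree_gt0]; rewrite ltr0n.
have DN0 := lt0r_neq0 D_gt0.
pose s := [seq `|x| / D | x <- spectrum R G].
have s01 t : t \in s -> 0 <= t <= 1.
  case/mapP=> x; rewrite spectrum_eigenvalue => /eigenvalue_le_max_degree xD ->.
  by rewrite divr_ge0 ?(ltW D_gt0) // ler_pdivrMr // mul1r.
have t2_le1 t : t \in s -> 0 <= 1 - t ^+ 2.
  by move=> /s01/andP[t_ge0 t_le1]; rewrite subr_ge0 expr_le1.
have sumE : \sum_(t <- s) t = energy R G / D by rewrite big_map mulr_suml.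
have sum2 : \sum_(t <- s) t ^+ 2 = B / D.
  rewrite big_map /B /moment !mulr_suml; apply: eq_bigr => x _.
  by rewrite expr_div_n real_normK ?num_real //; field.
have sum4 : \sum_(t <- s) t ^+ 2 * t ^+ 2 = A / D.
  rewrite big_map /A /moment !mulr_suml; apply: eq_bigr => x _.
  by rewrite expr_div_n real_normK ?num_real //; field.
(* The constant 1 sums to the length [n] of the spectrum, which is C/D. *)
have sumQ : \sum_(t <- s) (1 - t ^+ 2) = (C - B) / D.
  rewrite sumrB sum2 big_const_seq count_predT size_map size_spectrum.
  by rewrite iter_addr addr0 -/n /C; field.
have sumP : \sum_(t <- s) t ^+ 2 * (1 - t ^+ 2) = (B - A) / D.
  under eq_bigr do rewrite mulrBr mulr1.
  by rewrite sumrB sum2 sum4 mulrBl.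
have Q_ge0 : 0 <= C - B.
  have : 0 <= (C - B) / D by rewrite -sumQ big_seq; exact: sumr_ge0.
  by rewrite pmulr_lge0 ?invr_gt0.
have P_ge0 : 0 <= B - A.
  have : 0 <= (B - A) / D.
    rewrite -sumP big_seq; apply: sumr_ge0 => t ts.
    by rewrite mulr_ge0 ?sqr_ge0 ?t2_le1.
  by rewrite pmulr_lge0 ?invr_gt0.
have PleQ : B - A <= C - B.
  rewrite -(ler_pM2r (_ : 0 < D^-1)) ?invr_gt0 // -sumP -sumQ.
  rewrite big_seq [leRHS]big_seq; apply: ler_sum => t ts.
  (* The difference of the two terms is (1 - t^2)^2. *)
  by have := t2_le1 t ts => h; nra.
(* Since A - 2B + C = (C - B) - (B - A) and 0 <= B - A <= C - B, the equality C = B would make this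
   denominator zero. *)
have QN0 : C - B != 0.
  apply: contraNneq dN0 => Q0; apply/eqP.
  by move: PleQ P_ge0; rewrite Q0; lra.
rewrite [- A + B]addrC [- B + C]addrC.
set p := Num.sqrt (B - A); set q := Num.sqrt (C - B).
have p2 : p ^+ 2 = B - A by rewrite sqr_sqrtr.
have q2 : q ^+ 2 = C - B by rewrite sqr_sqrtr.
have p_ge0 : 0 <= p by exact: sqrtr_ge0.
have q_ge0 : 0 <= q by exact: sqrtr_ge0.
have a_ge0 : 0 <= p / q by exact: divr_ge0.
have mean : \sum_(t <- s) t ^+ 2 * (1 - t ^+ 2)
            = (p / q) ^+ 2 * \sum_(t <- s) (1 - t ^+ 2).
  by rewrite sumP sumQ expr_div_n p2 q2; field; rewrite DN0 QN0.
have [] := sum_le_weighted _ _ _ a_ge0 s01 mean.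
(* Every sum carries the factor 1/D. Once it is pulled out, the bound is the right-hand side of
   [energy_bound_alt], read backwards. *)
rewrite sumE sum2 sumQ -q2 mulrA -mulrDl -energy_bound_alt //; last first.
  by apply: contraNneq dN0; rewrite q2 p2 => PQ; apply/eqP; lra.
have -> : B + q ^+ 2 = C by rewrite q2; ring.
have -> : B - p ^+ 2 = A by rewrite p2; ring.
have -> : q ^+ 2 - p ^+ 2 = A - 2%:R * B + C by rewrite p2 q2; ring.
rewrite ler_pM2r ?invr_gt0 // => le_bound eq_bound; split=> //.
split=> [E_eq lam lam_ev | all_in].
  apply/norm_div_mem => //; apply: (proj1 eq_bound); first by rewrite E_eq.
  by apply/mapP; exists lam; rewrite ?spectrum_eigenvalue.
have D'N0 : D^-1 != 0 by rewrite invr_eq0.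
apply: (mulIf D'N0); apply/eq_bound => t /mapP[x].
rewrite spectrum_eigenvalue => /all_in/norm_div_mem H ->.
exact: H.
Qed.
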